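(* Let $A\in\mathbb{C}^{m\times n}$, $B\in\mathbb{C}^{m\times \ell}$, $C\in\mathbb{C}^{k\times n}$ and $D\in\mathbb{C}^{k\times \ell}$, and let $M$, $N$ be weights of order $m$ and $n$ respectively. If the Moore-Penrose inverse $A^{[\dagger]}$ (with respect to $M,N$) exists, then $$\operatorname{rank}\begin{pmatrix} A^{[*]}AA^{[*]} & A^{[*]}B\\ CA^{[*]} & D\end{pmatrix}=\operatorname{rank}\begin{pmatrix} D & CA^{[*]}\\ A^{[*]}B & A^{[*]}AA^{[*]}\end{pmatrix}=\operatorname{rank}(A)+\operatorname{rank}\left(D-CA^{[\dagger]}B\right).$$
   Context: All matrices are complex, and $X^*$ denotes the complex conjugate transpose of $X$. A weight of order $n$ is an invertible Hermitian $n\times n$ matrix (not necessarily positive definite). If $M$ and $N$ are weights of order $m$ and $n$, the $MN$-adjoint of $A\in\mathbb{C}^{m\times n}$ is $A^{[*]}=N^{-1}A^*M\in\mathbb{C}^{n\times m}$; for a square matrix acting on a space with weight $W$ the adjoint is $X^{[*]}=W^{-1}X^*W$. The Moore-Penrose inverse $A^{[\dagger]}$ of $A$ is the unique $X\in\mathbb{C}^{n\times m}$, if it exists, satisfying $AXA=A$, $XAX=X$, $(AX)^{[*]}=AX$ and $(XA)^{[*]}=XA$, where $AX\in\mathbb{C}^{m\times m}$ has adjoint taken with weight $M$ and $XA\in\mathbb{C}^{n\times n}$ with weight $N$. It need not exist. *)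

(* Defs.v *)
From HB Require Import structures.
From mathcomp Require Export all_boot all_order all_algebra.
From mathcomp Require Export complex reals.

Set Implicit Arguments.
Unset Strict Implicit.
Unset Printing Implicit Defensive.

Import GRing.Theory Num.Theory.
Local Open Scope ring_scope.
Local Open Scope sesquilinear_scope.

Definition weight (F : numClosedFieldType) (n : nat) (W : 'M[F]_n) : Prop :=
  W \is hermsymmx /\ W \in unitmx.

(* For a square matrix X on a space with weight W, the adjoint is [adj W W X]. *)
Definition adj (F : numClosedFieldType) (m n : nat)
    (M : 'M[F]_m) (N : 'M[F]_n) (A : 'M[F]_(m, n)) : 'M[F]_(n, m) :=
  invmx N *m A ^t* *m M.

Definition is_mpinv (F : numClosedFieldType) (m n : nat)
    (M : 'M[F]_m) (N : 'M[F]_n) (A : 'M[F]_(m, n)) (X : 'M[F]_(n, m)) : Prop :=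
  [/\ A *m X *m A = A,
      X *m A *m X = X,
      adj M M (A *m X) = A *m X
    & adj N N (X *m A) = X *m A].

Lemma adjM (F : numClosedFieldType) (m n p : nat)
    (M : 'M[F]_m) (N : 'M[F]_n) (P : 'M[F]_p)
    (A : 'M[F]_(m, n)) (B : 'M[F]_(n, p)) :
  N \in unitmx -> adj M P (A *m B) = adj N P B *m adj M N A.
Proof.
move=> uN; rewrite /adj trmx_mul map_mxM !mulmxA.
by rewrite -[_ *m N *m invmx N]mulmxA mulmxV // mulmx1.
Qed.

(* By uniqueness, a hypothesis [is_mpinv M N A X] says exactly that the      *)
(* Moore-Penrose inverse of A exists, and names it X.                        *)
Lemma is_mpinv_unique (F : numClosedFieldType) (m n : nat)
    (M : 'M[F]_m) (N : 'M[F]_n) (A : 'M[F]_(m, n)) (X Y : 'M[F]_(n, m)) :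
  weight M -> weight N -> is_mpinv M N A X -> is_mpinv M N A Y -> X = Y.
Proof.
move=> [_ uM] [_ uN] [AX XA hAX hXA] [AY YA hAY hYA].
have eAXY : A *m X = A *m Y.
  rewrite -{1}AY -mulmxA -{1}hAY -{1}hAX -adjM //.
  by rewrite mulmxA AX.
have eXYA : X *m A = Y *m A.
  rewrite -{1}AY -mulmxA mulmxA -{1}hXA -{1}hYA -adjM //.
  by rewrite -mulmxA [A *m (_ *m _)]mulmxA AX.
by rewrite -XA -mulmxA eAXY mulmxA eXYA YA.
Qed.

(* Main.v *)
Require Import Defs.

Set Implicit Arguments.
Unset Strict Implicit.
Unset Printing Implicit Defensive.

Import GRing.Theory.
Local Open Scope ring_scope.

(** Write S for the adjoint of A, X for its Moore-Penrose inverse, and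
    G = S A S for the large diagonal block.  The off-diagonal blocks S B and
    C S lie in the column and row space of G, so block elimination splits the
    matrix into G and a Schur complement even though G may be singular
    (mxrank_block_schur).

    The elimination coefficients come from K = Y X Y, where Y is the adjoint
    of X.  Taking adjoints in the Penrose equations yields
    S A X = S = X A S and X Y S = X = S Y X, hence S K S = X
    (mpinv_sandwich_adj).  Therefore
    G K S = S A X = S and S K G = X A S = S, which exhibits S B = G (K S B) and
    C S = (C S K) G, and the Schur complement is D - C (S K G K S) B, that is,
    D - C X B.  The same equation S = S K G shows that G has the rank of S, and
    S has the rank of A because conjugate transposition and multiplication by
    invertible weights preserve rank (mxrank_adj). *)

Section BlockRank.

Variable F : fieldType.

Lemma mxrank_block_swap (m1 m2 n1 n2 : nat)
    (E : 'M[F]_(m1, n1)) (B : 'M[F]_(m1, n2))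
    (C : 'M[F]_(m2, n1)) (D : 'M[F]_(m2, n2)) :
  \rank (block_mx E B C D) = \rank (block_mx D C B E).
Proof.
have rank_col_mxC p q r (U : 'M[F]_(p, r)) (V : 'M[F]_(q, r)) :
    \rank (col_mx U V) = \rank (col_mx V U).
  by rewrite -!addsmxE addsmxC.
rewrite [in LHS]block_mxEv rank_col_mxC -block_mxEv block_mxEh.
by rewrite -mxrank_tr tr_row_mx rank_col_mxC -tr_row_mx mxrank_tr -block_mxEh.
Qed.

(** Guttman's rank formula with the block E possibly singular: its inverse is
    replaced by explicit witnesses P, Q that the neighbouring blocks are
    multiples of E, which is all that the block LDU factorization uses. *)
Lemma mxrank_block_schur (m1 m2 n1 n2 : nat) (E : 'M[F]_(m1, n1))
    (P : 'M[F]_(m2, m1)) (Q : 'M[F]_(n1, n2)) (D : 'M[F]_(m2, n2)) :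
  \rank (block_mx E (E *m Q) (P *m E) D)
    = (\rank E + \rank (D - P *m E *m Q)%R)%N.
Proof.
pose Lo : 'M[F]_(m1 + m2) := block_mx 1%:M 0 P 1%:M.
pose Up : 'M[F]_(n1 + n2) := block_mx 1%:M Q 0 1%:M.
have Lo_unit : Lo \in unitmx by rewrite unitmxE det_lblock !det1 mulr1 unitr1.
have Up_unit : Up \in unitmx by rewrite unitmxE det_ublock !det1 mulr1 unitr1.
have -> : block_mx E (E *m Q) (P *m E) D
    = Lo *m block_mx E 0 0 (D - P *m E *m Q) *m Up.
  rewrite !mulmx_block !(mul1mx, mulmx1, mul0mx, mulmx0, addr0, add0r).
  by rewrite addrC subrK.
rewrite mxrankMfree ?row_free_unit // -mxrank_tr trmx_mul.
by rewrite mxrankMfree ?row_free_unit ?unitmx_tr // mxrank_tr rank_diag_block_mx.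
Qed.

End BlockRank.

Section IndefiniteAdjoint.

Variables (F : numClosedFieldType) (m n : nat).
Variables (M : 'M[F]_m) (N : 'M[F]_n).
Hypotheses (uM : M \in unitmx) (uN : N \in unitmx).

Lemma mxrank_adj (A : 'M[F]_(m, n)) : \rank (adj M N A) = \rank A.
Proof.
rewrite /adj mxrankMfree ?row_free_unit // -mxrank_tr trmx_mul.
rewrite mxrankMfree ?row_free_unit ?unitmx_tr ?unitmx_inv //.
by rewrite mxrank_tr mxrank_map mxrank_tr.
Qed.

Variables (A : 'M[F]_(m, n)) (X : 'M[F]_(n, m)).
Hypothesis hX : is_mpinv M N A X.

Lemma adj_mul_mpinv : adj M N A *m A *m X = adj M N A.
Proof.
have [AXA _ hAX _] := hX.
by rewrite -mulmxA -{1}hAX -adjM // AXA.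
Qed.

Lemma mpinv_mul_adj : X *m A *m adj M N A = adj M N A.
Proof.
have [AXA _ _ hXA] := hX.
by rewrite -{1}hXA -adjM // mulmxA AXA.
Qed.

(** Since A X and X A are self-adjoint, X (A X) and (X A) X can each be
    rewritten with the adjoint of A as an outer factor on one side; inserting
    one form into the other puts it on both sides at once. *)
Lemma mpinv_sandwich_adj :
  adj M N A *m (adj N M X *m X *m adj N M X) *m adj M N A = X.
Proof.
have [_ XAX hAX hXA] := hX.
have SYX : adj M N A *m adj N M X *m X = X by rewrite -adjM // hXA XAX.
have XYS : X *m adj N M X *m adj M N A = X.
  by rewrite -mulmxA -adjM // hAX mulmxA XAX.
(* The adjoint unfolds to a product, which reassociation would break open. *)
move: (adj M N A) (adj N M X) SYX XYS => S Y SYX XYS.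
by rewrite !mulmxA SYX XYS.
Qed.

End IndefiniteAdjoint.

Theorem theorem3p4 (R : realType) (m n l k : nat)
    (A : 'M[R[i]]_(m, n)) (B : 'M[R[i]]_(m, l))
    (C : 'M[R[i]]_(k, n)) (D : 'M[R[i]]_(k, l))
    (M : 'M[R[i]]_m) (N : 'M[R[i]]_n) (Adag : 'M[R[i]]_(n, m))
    (hM : weight M) (hN : weight N) (hAdag : is_mpinv M N A Adag) :
  \rank (block_mx (adj M N A *m A *m adj M N A) (adj M N A *m B)
                  (C *m adj M N A)              D)
    = \rank (block_mx D              (C *m adj M N A)
                      (adj M N A *m B) (adj M N A *m A *m adj M N A))
  /\ \rank (block_mx D              (C *m adj M N A)
                      (adj M N A *m B) (adj M N A *m A *m adj M N A))
    = (\rank A + \rank (D - C *m Adag *m B)%R)%N.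
Proof.
have [[_ uM] [_ uN]] := (hM, hN).
split; first exact: mxrank_block_swap.
rewrite mxrank_block_swap -(mxrank_adj uM uN A).
have SAX := adj_mul_mpinv uM hAdag.
have XAS := mpinv_mul_adj uN hAdag.
have SKS := mpinv_sandwich_adj uM uN hAdag.
(* The rest is algebra of S and K subject to the three equations. *)
move: (adj M N A) (_ *m adj N M Adag) SAX XAS SKS => S K SAX XAS SKS.
set G := S *m A *m S.
have GKS : G *m K *m S = S.
  by rewrite /G -!mulmxA [S *m (K *m S)]mulmxA SKS mulmxA.
have SKG : S *m K *m G = S by rewrite /G !mulmxA SKS.
have SB : S *m B = G *m (K *m S *m B) by rewrite !mulmxA GKS.
have CS : C *m S = C *m S *m K *m G.
  by rewrite -(mulmxA C) -(mulmxA C) SKG.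
have CXB : C *m Adag *m B = C *m S *m K *m G *m (K *m S *m B).
  by rewrite -CS -SKS !mulmxA.
have rankG : \rank G = \rank S.
  apply/eqP; rewrite eqn_leq mxrankM_maxr /=.
  by rewrite -{1}SKG mxrankM_maxr.
by rewrite SB [in LHS]CS mxrank_block_schur CXB rankG.
Qed.
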